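(* Let $n,m$ be positive integers and $\alpha_1,\dots,\alpha_n$ the simple roots of type $A_n$. There exists a bijection $\psi_n:\mathcal{D}^m_n\to\mathcal{P}^m_n$ such that for every $i\in\{1,\dots,n\}$ and every $D\in\mathcal{D}^m_n$, the facet $D$ contains the negative simple root $-\alpha_i$ if and only if the $i$-th part of the partition $\psi_n(D)$ equals $(n-i+1)m$.
   Context: Let $P$ be a convex polygon with $m(n+1)+2$ vertices labeled $0,1,\dots,m(n+1)+1$ counterclockwise. An $m$-diagonal is a diagonal of $P$ dividing it into two polygons each with a number of vertices congruent to $2$ mod $m$. An $m$-dissection is a set of $n$ pairwise non-crossing $m$-diagonals; $\mathcal{D}^m_n$ is the set of $m$-dissections (the facets of the $m$-generalized cluster complex $\Delta^m(A_n)$). Negative simple roots: for $1\le i\le\frac{n+1}2$, $-\alpha_{2i-1}$ is the diagonal joining vertices $(i-1)m$ and $(n+1-i)m+1$; for $1\le i\le\frac n2$, $-\alpha_{2i}$ is the diagonal joining $im$ and $(n+1-i)m+1$. $D$ contains $-\alpha_i$ if that diagonal is in $D$. $\mathcal{P}^m_n$ is the set of integer partitions $\lambda=(\lambda_1\ge\cdots\ge\lambda_n\ge0)$ with $\lambda_i\le m(n-i+1)$ for all $i$. *)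

(* Defs.v *)
From mathcomp Require Import all_boot.
Set Implicit Arguments. Unset Strict Implicit. Unset Printing Implicit Defensive.

Definition nverts (n m : nat) : nat := m * n.+1 + 2.

(* A diagonal is encoded as an ordered pair (a, b) of vertices with a < b.
   It is a genuine diagonal (not a side) iff 2 <= b - a <= N - 2.
   It splits P into polygons with b - a + 1 and N - (b - a) + 1 vertices. *)
Definition is_m_diagonal (n m : nat) (d : 'I_(nverts n m) * 'I_(nverts n m)) : bool :=
  let a := val d.1 in let b := val d.2 in
  [&& a < b, 2 <= b - a, b - a <= nverts n m - 2,
      b - a + 1 == 2 %[mod m] & nverts n m - (b - a) + 1 == 2 %[mod m]].

Definition crossing (N : nat) (d1 d2 : 'I_N * 'I_N) : bool :=
  let a := val d1.1 in let b := val d1.2 in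
  let c := val d2.1 in let d := val d2.2 in
  ((a < c) && (c < b) && (b < d)) || ((c < a) && (a < d) && (d < b)).

Definition is_m_dissection (n m : nat) (D : {set 'I_(nverts n m) * 'I_(nverts n m)}) : bool :=
  [&& #|D| == n,
      [forall d in D, @is_m_diagonal n m d] &
      [forall d1 in D, forall d2 in D, ~~ crossing d1 d2]].

(* Negative simple root -alpha_i (i is 1-indexed) as the pair of vertex labels:
   i = 2k-1 : vertices (k-1)m and (n+1-k)m+1;  i = 2k : vertices km and (n+1-k)m+1. *)
Definition neg_simple_root (n m i : nat) : nat * nat :=
  if odd i then let k := i.+1./2 in ((k - 1) * m, (n + 1 - k) * m + 1)
  else let k := i./2 in (k * m, (n + 1 - k) * m + 1).

Definition contains_neg_simple (n m i : nat) (D : {set 'I_(nverts n m) * 'I_(nverts n m)}) : bool :=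
  [exists d in D, (val d.1, val d.2) == neg_simple_root n m i].

(* P^m_n : partitions lambda_1 >= ... >= lambda_n >= 0 with lambda_i <= m(n-i+1).
   Encoded as an n-tuple, 0-indexed: entry j is lambda_{j+1}. *)
Definition is_mpartition (n m : nat) (la : n.-tuple nat) : bool :=
  [forall j : 'I_n, tnth la j <= m * (n - j)] &&
  [forall j : 'I_n, forall k : 'I_n, (j <= k) ==> (tnth la k <= tnth la j)].

(* Main.v *)
(* Adding the base edge of P to an m-dissection gives K = n+1 pairwise
   non-crossing arcs, each joining a to a + k m + 1 for some k >= 1.  An arc of
   this kind splits a dissection of size K into an inner one of size k and,
   contracting what it cuts off, an outer one of size K - k.  Likewise an
   increasing sequence mu_0 <= ... <= mu_(K-1) with mu_i <= i m and mu_k = k m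
   splits at k into sequences of lengths k and K - k.  Removing the ear at the
   rightmost left endpoint matches dissections with such sequences, so for each
   nested chain of arcs of sizes n, ..., 1, in particular for the snake of
   negative simple roots, and each set S of sizes, the dissections containing
   the arcs with size in S are as many as the sequences tight at S.  By
   inclusion-exclusion the numbers of objects with exactly S as set of
   arcs, resp. tight indices, agree too, hence a bijection respecting S. *)
Require Import Defs.
From mathcomp Require Import all_boot.
From mathcomp Require Import finmap zify.

Set Implicit Arguments.
Unset Strict Implicit.
Unset Printing Implicit Defensive.

Local Open Scope fset_scope.
Local Open Scope pair_scope.
Local Open Scope nat_scope.

(** * Arcs under shifting and widening *)

Definition cross (d e : nat * nat) : bool :=
  [&& d.1 < e.1, e.1 < d.2 & d.2 < e.2] || [&& e.1 < d.1, d.1 < e.2 & e.2 < d.2].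

(* The arcs of the polygon with vertices 0, ..., K m + 1, base edge included. *)
Definition arc (m K : nat) (d : nat * nat) : bool :=
  [&& d.1.+1 < d.2, m %| d.2 - d.1.+1 & d.2 <= (K * m).+1].

Definition noncrossing (m K : nat) (D : {fset nat * nat}) : Prop :=
  {in D, forall d, arc m K d} /\ {in D &, forall d e, ~~ cross d e}.

Definition dissection (m K : nat) (D : {fset nat * nat}) : Prop :=
  noncrossing m K D /\ #|` D| = K.

Definition shift (a : nat) (d : nat * nat) : nat * nat := (d.1 + a, d.2 + a).

Definition stretch (a c x : nat) : nat := if x <= a then x else x + c.

Definition widen (a c : nat) (d : nat * nat) : nat * nat :=
  (stretch a c d.1, stretch a c d.2).

(* [A] is placed on the vertices from [a] to [a + c + 1], and the edge from [a]
   to [a + 1] of the polygon of [B] is stretched to span it. *)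
Definition glue (a c : nat) (A B : {fset nat * nat}) : {fset nat * nat} :=
  [fset shift a d | d in A] `|` [fset widen a c d | d in B].

Lemma shift_inj a : injective (shift a).
Proof. by move=> [x y] [z t] [] /addIn -> /addIn ->. Qed.

Lemma stretch_inj a c : injective (stretch a c).
Proof. by move=> x y; rewrite /stretch; do 2![case: (leqP _ a) => ?]; lia. Qed.

Lemma widen_inj a c : injective (widen a c).
Proof. by move=> [x y] [z t] [] /stretch_inj -> /stretch_inj ->. Qed.

Lemma ltn_stretch a c x y : (stretch a c x < stretch a c y) = (x < y).
Proof. by rewrite /stretch; do 2![case: (leqP _ a) => ?]; lia. Qed.

Lemma cross_shift a d e : cross (shift a d) (shift a e) = cross d e.
Proof. by rewrite /cross /= !ltn_add2r. Qed.

Lemma cross_widen a c d e : cross (widen a c d) (widen a c e) = cross d e.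
Proof. by rewrite /cross /= !ltn_stretch. Qed.

Lemma crossC d e : cross d e = cross e d.
Proof. by rewrite /cross orbC. Qed.

(** The strict inequality in [arc] makes both the quotient [k] and [m] positive, so [m] cancels in
    the bound on [d.2]. *)
Lemma arc_gap m K d : arc m K d -> exists2 k, 0 < k <= K & d.2 = (d.1 + k * m).+1.
Proof.
case/and3P => lt12 /dvdnP[k Ek] le2; exists k; last by lia.
have k_gt0 : 0 < k by case: k Ek; lia.
have m_gt0 : 0 < m by case: m Ek {le2}; lia.
by rewrite k_gt0 -(leq_pmul2r m_gt0); lia.
Qed.

Lemma arc_shift m K k a d : k <= K -> a <= (K - k) * m -> arc m k d -> arc m K (shift a d).
Proof.
move=> lekK; rewrite mulnBl => lea; have lekm : k * m <= K * m by rewrite leq_mul2r lekK orbT.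
case/and3P => lt12 dv le2; apply/and3P; split=> /=; [lia| |lia].
by rewrite -addSn subnDr.
Qed.

Lemma arc_unshift m K k a d :
  arc m K (shift a d) -> d.2 <= (k * m).+1 -> arc m k d.
Proof.
case/and3P => /= lt12 dv _ le2; apply/and3P; split=> //; first by lia.
by move: dv; rewrite -addSn subnDr.
Qed.

(** An arc with [d.1 <= a < d.2] grows by [k * m] and any other keeps its length, so the residue
    modulo [m] does not change. *)
Lemma arc_widen m K k a d : k <= K -> arc m (K - k) d -> arc m K (widen a (k * m) d).
Proof.
move=> lekK /and3P[]; rewrite mulnBl => lt12 dv le2.
have lekm : k * m <= K * m by rewrite leq_mul2r lekK orbT.
apply/and3P; rewrite /= /stretch; split; do ?[case: (leqP _ a) => ?]; try lia.
- by rewrite -(_ : d.2 - d.1.+1 + k * m = d.2 + k * m - d.1.+1) ?dvdn_addl ?dvdn_mull //; lia.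
- by rewrite -addSn subnDr.
Qed.

(** The side from [a] to [a.+1] widens to an arc, hence the assumption [d.1.+1 < d.2]. The bound on
    [a] serves when [d.2 <= a]: such an endpoint is not moved, and its bound by [K] is too weak. *)
Lemma arc_unwiden m K k a d : a <= (K - k) * m -> d.1.+1 < d.2 ->
  arc m K (widen a (k * m) d) -> arc m (K - k) d.
Proof.
move=> lea lt12 /and3P[/= _ dv le2]; apply/and3P; split=> //.
  move: dv; rewrite /stretch; do ?[case: (leqP _ a) => ?]; try lia.
  - by rewrite (_ : _ - _ = d.2 - d.1.+1 + k * m) ?dvdn_addl ?dvdn_mull //; lia.
  - by rewrite -addSn subnDr.
by move: le2 lea; rewrite /stretch mulnBl; case: (leqP _ a); lia.
Qed.

(** * Gluing two families and cutting along an arc *)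

Lemma glueP a c (A B : {fset nat * nat}) d :
  reflect ((exists2 e, e \in A & d = shift a e) \/ (exists2 e, e \in B & d = widen a c e))
    (d \in glue a c A B).
Proof.
rewrite in_fsetU; apply: (iffP orP) => -[] H.
- by left; case/imfsetP: H => e; exists e.
- by right; case/imfsetP: H => e; exists e.
- by left; case: H => e eA ->; apply: in_imfset.
- by right; case: H => e eA ->; apply: in_imfset.
Qed.

Lemma arc_shiftNwiden m k K a d e : arc m k d -> arc m K e -> shift a d <> widen a (k * m) e.
Proof.
case/and3P=> d12 _ d2; case/and3P=> e12 _ _ [].
by rewrite /stretch; do 2![case: (leqP _ a) => ?]; lia.
Qed.

Lemma noncrossing_glue m K k a A B : k <= K -> a <= (K - k) * m ->
  noncrossing m k A -> noncrossing m (K - k) B -> noncrossing m K (glue a (k * m) A B).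
Proof.
move=> lekK lea [arcA crA] [arcB crB].
(* A crossing would put a stretched endpoint strictly between those of the shifted arc, inside the
   interval that stretching skips. *)
have crAB d e : d \in A -> ~~ cross (shift a d) (widen a (k * m) e).
  move=> /arcA /and3P[d12 _ d2]; rewrite /cross /= /stretch.
  by do 2![case: (leqP _ a) => ?]; lia.
split=> [d /glueP[[e eA ->]|[e eB ->]]|].
- exact: arc_shift (arcA _ eA).
- exact: arc_widen (arcB _ eB).
- move=> d e /glueP[[f fA ->]|[f fB ->]] /glueP[[g gA ->]|[g gB ->]].
  + by rewrite cross_shift crA.
  + exact: crAB.
  + by rewrite crossC; apply: crAB.
  + by rewrite cross_widen crB.
Qed.

Lemma card_glue m K k a A B : noncrossing m k A -> noncrossing m K B ->
  #|` glue a (k * m) A B| = #|` A| + #|` B|.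
Proof.
move=> [arcA _] [arcB _]; rewrite cardfsU.
rewrite (_ : _ `&` _ = fset0).
  rewrite cardfs0 subn0 card_imfset; last exact: shift_inj.
  by rewrite card_imfset; last exact: widen_inj.
apply/fsetP => d; rewrite in_fsetI in_fset0; apply/negP => /andP[].
case/imfsetP => e /= eA -> /imfsetP[f /= fB].
exact: arc_shiftNwiden (arcA _ eA) (arcB _ fB).
Qed.

Lemma in_glue_shift m K k a A B d : arc m k d -> noncrossing m K B ->
  (shift a d \in glue a (k * m) A B) = (d \in A).
Proof.
move=> arcd [arcB _]; apply/glueP/idP => [[[e eA /shift_inj -> //]|[e eB]]|dA].
  by move=> /(arc_shiftNwiden arcd (arcB _ eB)).
by left; exists d.
Qed.

Lemma in_glue_widen m K k a A B d : noncrossing m k A -> arc m K d ->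
  (widen a (k * m) d \in glue a (k * m) A B) = (d \in B).
Proof.
move=> [arcA _] arcd; apply/glueP/idP => [[[e eA]|[e eB /widen_inj -> //]]|dB].
  by move=> /esym /(arc_shiftNwiden (arcA _ eA) arcd).
by right; exists d.
Qed.

Lemma glue_inj m K k a A B A' B' :
  noncrossing m k A -> noncrossing m K B -> noncrossing m k A' -> noncrossing m K B' ->
  glue a (k * m) A B = glue a (k * m) A' B' -> A = A' /\ B = B'.
Proof.
move=> ncA ncB ncA' ncB' E; split; apply/fsetP => d; apply/idP/idP => dI.
- by rewrite -(in_glue_shift a A' (ncA.1 _ dI) ncB') -E (in_glue_shift a A (ncA.1 _ dI) ncB).
- by rewrite -(in_glue_shift a A (ncA'.1 _ dI) ncB) E (in_glue_shift a A' (ncA'.1 _ dI) ncB').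
- by rewrite -(in_glue_widen a B' ncA' (ncB.1 _ dI)) -E (in_glue_widen a B ncA (ncB.1 _ dI)).
- by rewrite -(in_glue_widen a B ncA (ncB'.1 _ dI)) E (in_glue_widen a B' ncA' (ncB'.1 _ dI)).
Qed.

(** The given arc becomes the base edge of the inner family [A] and a side of the outer polygon,
    that of [B]. *)
Lemma noncrossing_unglue m K k a D :
  noncrossing m K D -> 0 < k -> (a, (a + k * m).+1) \in D ->
  exists A B, [/\ noncrossing m k A, noncrossing m (K - k) B,
    (0, (k * m).+1) \in A & D = glue a (k * m) A B].
Proof.
move=> [arcD crD] k_gt0 abD.
have lea : a <= (K - k) * m.
  by case/and3P: (arcD _ abD); rewrite mulnBl /=; lia.
pose inside (d : nat * nat) := (a <= d.1) && (d.2 <= (a + k * m).+1).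
pose contract x := if x <= a then x else x - k * m.
pose A := [fset (d.1 - a, d.2 - a) | d in D & inside d].
pose B := [fset (contract d.1, contract d.2) | d in D & ~~ inside d].
have shA d : d \in A -> shift a d \in D /\ d.2 <= (k * m).+1.
  case/imfsetP => -[x y] /= /andP[xyD /andP[/= lex ley]] ->.
  have /and3P[/= ltxy _ _] := arcD _ xyD.
  rewrite /shift /= (_ : (_, _) = (x, y)); first by split=> //; lia.
  by congr pair; lia.
have wiB d : d \in B -> widen a (k * m) d \in D /\ d.1.+1 < d.2.
  case/imfsetP => -[x y] /= /andP[xyD /= Nin] ->.
  have /and3P[/= ltxy _ _] := arcD _ xyD.
  (* Not crossing the cutting arc keeps the endpoints of an outside arc off its interior, where
     [contract] would fail to be undone by [stretch]. *)
  have Ncr := crD _ _ xyD abD; rewrite /widen /=.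
  suff [-> -> lt12] : [/\ stretch a (k * m) (contract x) = x,
    stretch a (k * m) (contract y) = y & (contract x).+1 < contract y] by [].
  move: Nin Ncr; rewrite /inside /cross /= /contract /stretch => Nin Ncr.
  by case: (leqP x a) => ?; case: (leqP y a) => ?; split; do ?[case: (leqP _ a) => ?]; lia.
exists A, B; split.
- split=> [d /shA[dD le2]|d e /shA[dD _] /shA[eD _]].
    exact: arc_unshift (arcD _ dD) le2.
  by rewrite -(cross_shift a) crD.
- split=> [d /wiB[dD lt12]|d e /wiB[dD _] /wiB[eD _]].
    exact: arc_unwiden lea lt12 (arcD _ dD).
  by rewrite -(cross_widen a (k * m)) crD.
- apply/imfsetP; exists (a, (a + k * m).+1).
    by rewrite /= !inE abD /inside /= !leqnn.
  by congr pair; rewrite /=; lia.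
- apply/fsetP => d; apply/idP/glueP => [dD|[[e /shA[eD _] -> //]|[e /wiB[eD _] -> //]]].
  have /and3P[lt12 _ _] := arcD _ dD; have Ncr := crD _ _ dD abD.
  case: (boolP (inside d)) => Hin; [left|right].
    exists (d.1 - a, d.2 - a); first by apply/imfsetP; exists d; rewrite //= !inE dD.
    by case: d Hin lt12 {dD Ncr} => x y /andP[/= lex ley] lt12; rewrite /shift /=; congr pair; lia.
  exists (contract d.1, contract d.2); first by apply/imfsetP; exists d; rewrite //= !inE dD.
  case: d Hin Ncr lt12 {dD} => x y.
  rewrite /inside /cross /= /contract /widen /stretch /= => Nin Ncr lt12.
  by case: (leqP x a) => ?; case: (leqP y a) => ?; congr pair; do ?[case: (leqP _ a) => ?]; lia.
Qed.

(** * Maximal size and the base edge *)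

(** Strong induction: an arc other than the base edge cuts [D] into families bounded by [k] and
    [K - k], both smaller than [K]. If there is none, [D] has at most one element. *)
Lemma noncrossing_card m K D : noncrossing m K D -> #|` D| <= K.
Proof.
elim/ltn_ind: K D => K IH D ncD.
have [[d dD Nbase]|allbase] : (exists2 d, d \in D & d <> (0, (K * m).+1)) \/
    (forall d, d \in D -> d = (0, (K * m).+1)).
- case: (boolP [exists d : D, val d != (0, (K * m).+1)]) => [/existsP[d /eqP dN]|].
    by left; exists (val d) => //; apply: valP.
  rewrite negb_exists => /forallP H; right=> d dD.
  by have := H [` dD]; rewrite negbK => /eqP.
- have [k /andP[k_gt0 lekK] Ek] := arc_gap (ncD.1 _ dD).
  have dE : (d.1, (d.1 + k * m).+1) \in D by rewrite -Ek -surjective_pairing.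
  (* An arc of size [K] has no room to start anywhere but at 0, so it would be the base edge. *)
  have ltkK : k < K.
    rewrite ltn_neqAle lekK andbT; apply/eqP => EkK; apply: Nbase.
    have /and3P[_ _] := ncD.1 _ dD; rewrite Ek EkK.
    by case: d Ek {dD dE} => x y /= -> /= lex; congr pair; rewrite ?EkK; lia.
  have [A [B [ncA ncB _ ->]]] := noncrossing_unglue ncD k_gt0 dE.
  rewrite (card_glue _ ncA ncB) -[leqRHS](subnKC lekK).
  by apply: leq_add; apply: IH => //; lia.
- case: (fset_0Vmem D) => [->|[d dD]]; first by rewrite cardfs0.
  have [k /andP[k_gt0 lekK] _] := arc_gap (ncD.1 _ dD).
  apply: leq_trans (leq_trans k_gt0 lekK).
  rewrite -(cardfs1 (0, (K * m).+1)); apply: fsubset_leq_card.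
  by apply/fsubsetP => e /allbase ->; rewrite in_fset1.
Qed.

Lemma dissection_glue m K k a A B : k <= K -> a <= (K - k) * m ->
  dissection m k A -> dissection m (K - k) B -> dissection m K (glue a (k * m) A B).
Proof.
move=> lekK lea [ncA cA] [ncB cB]; split; first exact: noncrossing_glue.
by rewrite (card_glue _ ncA ncB) cA cB subnKC.
Qed.

(** The two pieces have at most [k] and [K - k] arcs and together exactly [K], so both bounds are
    attained. *)
Lemma dissection_unglue m K k a D :
  dissection m K D -> 0 < k -> (a, (a + k * m).+1) \in D ->
  exists A B, [/\ dissection m k A, dissection m (K - k) B, k <= K,
    a <= (K - k) * m & D = glue a (k * m) A B].
Proof.
move=> [ncD cD] k_gt0 abD.
have [A [B [ncA ncB base ED]]] := noncrossing_unglue ncD k_gt0 abD.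
have lea : (a + k * m).+1 <= (K * m).+1 by case/and3P: (ncD.1 _ abD).
have leA := noncrossing_card ncA; have leB := noncrossing_card ncB.
have card : #|` A| + #|` B| = K by rewrite -cD ED (card_glue _ ncA ncB).
(* That the base edge of [A] is an arc gives [0 < m], which allows cancelling [m] in [lea]. *)
have lekK : k <= K.
  have /and3P[] := ncA.1 _ base; move=> /= ltk _ _.
  by rewrite -(leq_pmul2r (m := m)); [lia | case: m ltk {ED base ncA ncB lea abD ncD}; lia].
by exists A, B; split=> //; [split=> //; lia | split=> //; lia | rewrite mulnBl; lia].
Qed.

Lemma noncrossing_base m K D : 0 < m -> 0 < K ->
  noncrossing m K D -> noncrossing m K ((0, (K * m).+1) |` D).
Proof.
move=> m_gt0 K_gt0 [arcD crD].
have arcb : arc m K (0, (K * m).+1).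
  by rewrite /arc /= subSS subn0 dvdn_mull // leqnn !andbT ltnS muln_gt0 K_gt0.
have crb d : d \in D -> ~~ cross (0, (K * m).+1) d.
  by move=> /arcD /and3P[_ _]; rewrite /cross /=; lia.
split=> [d|d e]; first by case/fset1UP => [->|/arcD].
case/fset1UP => [->|dD] /fset1UP[->|eD]; last exact: crD.
- by rewrite /cross.
- exact: crb.
- by rewrite crossC; apply: crb.
Qed.

(** The base edge crosses nothing, so a family lacking it could be enlarged beyond the maximal
    size. *)
Lemma dissection_base m K D : 0 < m -> 0 < K -> dissection m K D -> (0, (K * m).+1) \in D.
Proof.
move=> m_gt0 K_gt0 [ncD cD]; apply/idPn => base.
by have := noncrossing_card (noncrossing_base m_gt0 K_gt0 ncD); rewrite cardfsU1 base cD ltnn.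
Qed.

(** * Bounded increasing sequences and their tight indices *)

(* Partitions are read in increasing order and preceded by the forced part 0,
   so that index [k] corresponds to arcs spanning [k * m + 1] edges. *)
Definition part (m K : nat) (s : seq nat) : bool :=
  [&& size s == K, sorted leq s & all (fun i => nth 0 s i <= i * m) (iota 0 K)].

Lemma partP m K s :
  reflect [/\ size s = K, forall i j, i <= j -> j < K -> nth 0 s i <= nth 0 s j
            & forall i, i < K -> nth 0 s i <= i * m] (part m K s).
Proof.
apply: (iffP and3P) => [[/eqP sz srt /allP bnd]|[sz srt bnd]].
  split=> // [i j leij ltjK|i ltiK].
    by apply: (sorted_leq_nth leq_trans leqnn); rewrite ?inE ?sz //; apply: leq_ltn_trans ltjK.
  by apply: bnd; rewrite mem_iota.
split; first exact/eqP.
- by apply/(sortedP 0) => i lti; apply: srt; rewrite -?sz.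
- by apply/allP => i; rewrite mem_iota => /andP[_]; apply: bnd.
Qed.

Lemma part_rcons m K s v : part m K.+1 (rcons s v) = [&& part m K s, last 0 s <= v & v <= K * m].
Proof.
apply/partP/and3P => [[]|[/partP[sz srt bnd] le_v v_le]].
  rewrite size_rcons => -[sz] srt bnd.
  have nthS i : i < K -> nth 0 (rcons s v) i = nth 0 s i by rewrite nth_rcons sz => ->.
  have nthK : nth 0 (rcons s v) K = v by rewrite nth_rcons sz ltnn eqxx.
  split.
  - apply/partP; split=> // [i j leij ltjK|i ltiK].
      by rewrite -!nthS ?srt // ?(leq_ltn_trans leij) // ltnW.
    by rewrite -nthS ?bnd // ltnW.
  - rewrite -nth_last sz; case: K sz srt nthS nthK {bnd} => [|K] sz srt nthS nthK.
      by rewrite nth_default ?sz.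
    by rewrite -[leqRHS]nthK -nthS // srt.
  - by rewrite -[leqLHS]nthK bnd.
split; first by rewrite size_rcons sz.
- move=> i j leij; rewrite ltnS !nth_rcons sz => lejK.
  case: (ltngtP j K) lejK => // [ltjK _|eqjK _].
    by rewrite (leq_ltn_trans leij ltjK) srt.
  case: (ltngtP i K) => // ltiK.
  apply: leq_trans le_v.
  by rewrite -nth_last srt ?sz //; lia.
- move=> i; rewrite ltnS nth_rcons sz leq_eqVlt => /orP[/eqP->|ltiK].
    by rewrite ltnn eqxx.
  by rewrite ltiK bnd.
Qed.

(** By monotonicity every entry from the tight index on is at least [k * m], so the truncated
    subtraction loses nothing. *)
Lemma part_split m K k s : k < K -> part m K s -> nth 0 s k = k * m ->
  let t := [seq x - k * m | x <- drop k s] in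
  [/\ part m k (take k s), part m (K - k) t & s = take k s ++ [seq x + k * m | x <- t]].
Proof.
move=> ltkK /partP[sz srt bnd] tight t.
have le_k i : k <= i -> i < K -> k * m <= nth 0 s i by move=> ? ?; rewrite -tight srt.
split.
- apply/partP; split=> [|i j leij ltjk|i ltik]; first by rewrite size_takel // sz ltnW.
    by rewrite !nth_take ?srt ?(ltn_trans _ ltkK) // (leq_ltn_trans leij).
  by rewrite nth_take ?bnd // (ltn_trans ltik).
- have szt : size t = K - k by rewrite size_map size_drop sz.
  have nthE i : i < K - k -> nth 0 t i = nth 0 s (k + i) - k * m.
    by move=> lti; rewrite (nth_map 0) ?nth_drop // size_drop sz.
  apply/partP; split=> // [i j leij ltj|i lti].
    by rewrite !nthE ?(leq_ltn_trans leij) // leq_sub2r // srt ?leq_add2l //; lia.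
  by rewrite nthE // leq_subLR -mulnDl bnd //; lia.
- rewrite -[LHS](cat_take_drop k); congr cat; rewrite -map_comp -[LHS]map_id.
  apply/eq_in_map => x /(nthP 0)[i]; rewrite size_drop sz nth_drop => lti <- /=.
  by rewrite subnK // le_k //; lia.
Qed.

(** The first entry of [t] is at most [0 * m], hence 0, which is why index [k] becomes tight. *)
Lemma part_join m K k s t : k < K -> part m k s -> part m (K - k) t ->
  part m K (s ++ [seq x + k * m | x <- t]) /\ nth 0 (s ++ [seq x + k * m | x <- t]) k = k * m.
Proof.
move=> ltkK /partP[szs srts bnds] /partP[szt srtt bndt].
have nthr i : k <= i -> i < K ->
    nth 0 (s ++ [seq x + k * m | x <- t]) i = nth 0 t (i - k) + k * m.
  move=> leki ltiK; rewrite nth_cat szs ltnNge leki (nth_map 0) //; lia.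
have nthl i : i < k -> nth 0 (s ++ [seq x + k * m | x <- t]) i = nth 0 s i.
  by rewrite nth_cat szs => ->.
split; last first.
  by rewrite nthr // subnn; have := bndt 0; rewrite subn_gt0 mul0n leqn0 => /(_ ltkK)/eqP->.
apply/partP; split=> [|i j leij ltjK|i ltiK].
- by rewrite size_cat size_map szs szt subnKC // ltnW.
- case: (leqP k j) => [lekj|ltjk].
    rewrite (nthr j) //; case: (leqP k i) => [leki|ltik].
      rewrite nthr ?leq_add2r ?srtt ?leq_sub2r ?(leq_ltn_trans leij) //.
      by rewrite ltn_sub2rE.
    rewrite nthl // (leq_trans (bnds _ ltik)) // (leq_trans _ (leq_addl _ _)) //.
    by rewrite leq_mul2r (ltnW ltik) orbT.
  by rewrite !nthl ?srts // (leq_ltn_trans leij).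
- case: (leqP k i) => [leki|ltik]; last by rewrite nthl // bnds.
  by rewrite nthr // -[in leqRHS](subnK leki) mulnDl leq_add2r bndt // ltn_sub2rE.
Qed.

Lemma part_enum m K : exists2 r : seq (seq nat), uniq r & forall s, (s \in r) = part m K s.
Proof.
exists [seq s <- undup [seq map val t | t : K.-tuple 'I_(K * m).+1] | part m K s].
  by rewrite filter_uniq // undup_uniq.
move=> s; rewrite mem_filter mem_undup; case: (boolP (part m K s)) => // /partP[sz srt bnd] /=.
have lt_s x : x \in s -> x < (K * m).+1.
  case/(nthP 0) => i; rewrite sz => ltiK <-; rewrite ltnS (leq_trans (bnd _ ltiK)) //.
  by rewrite leq_mul2r (ltnW ltiK) orbT.
have sz_t : size (map inord s : seq 'I_(K * m).+1) == K by rewrite size_map sz.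
apply/mapP; exists (Tuple sz_t); first by rewrite mem_enum.
rewrite /= -map_comp -[LHS]map_id; apply/eq_in_map => x /lt_s ltx /=.
by rewrite inordK.
Qed.

(** * Encoding dissections by successive ears *)

Definition ear (m : nat) : {fset nat * nat} := [fset (0, (1 * m).+1)].

(* The entries of [s] become the left endpoints of the arcs. *)
Definition build (m : nat) (s : seq nat) : {fset nat * nat} :=
  foldl (fun B v => glue v (1 * m) (ear m) B) fset0 s.

Lemma dissection0 m D : dissection m 0 D -> D = fset0.
Proof. by case=> _ /cardfs0_eq. Qed.

Lemma dissection1 m D : 0 < m -> dissection m 1 D -> D = ear m.
Proof.
move=> m_gt0 disD; have base := dissection_base m_gt0 (ltnSn 0) disD.
case: disD => _ /eqP/cardfs1P[d ED]; move: base; rewrite ED in_fset1 => /eqP <-.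
by [].
Qed.

Lemma dissection_fset0 m : dissection m 0 fset0.
Proof. by split; [split=> d; rewrite in_fset0 | rewrite cardfs0]. Qed.

Lemma arc_mul m K k x : 0 < m -> 0 < k -> x + k * m <= K * m -> arc m K (x, (x + k * m).+1).
Proof.
move=> m_gt0 k_gt0 le_x; apply/and3P; split=> //=.
  by rewrite ltnS -addn1 leq_add2l muln_gt0 k_gt0.
by rewrite subSS addKn dvdn_mull.
Qed.

Lemma dissection_ear m : 0 < m -> dissection m 1 (ear m).
Proof.
move=> m_gt0; split; last by rewrite cardfs1.
split=> [d|d e]; first by rewrite in_fset1 => /eqP->; apply: (@arc_mul m 1 1 0).
by rewrite !in_fset1 => /eqP-> /eqP->.
Qed.

Lemma build_rcons m s v : build m (rcons s v) = glue v (1 * m) (ear m) (build m s).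
Proof. by rewrite /build foldl_rcons. Qed.

Lemma build_ear m s v : (v, (v + 1 * m).+1) \in build m (rcons s v).
Proof.
rewrite build_rcons; apply/glueP; left; exists (0, (1 * m).+1); first by rewrite in_fset1.
by rewrite /shift /=; congr pair; lia.
Qed.

(** As the entries increase, each new ear is glued at or to the right of all earlier left endpoints,
    and widening leaves these in place. *)
Lemma build_left m K s d : part m K s -> d \in build m s -> d.1 <= last 0 s.
Proof.
elim/last_ind: s K d => [|s v IH] [|K] d; rewrite ?in_fset0 //.
  by case/partP; rewrite size_rcons.
rewrite part_rcons last_rcons build_rcons => /and3P[ps le_v _] /glueP[[e]|[e /(IH _ _ ps) lee ->]].
  by rewrite in_fset1 => /eqP-> ->.
by rewrite /= /stretch (leq_trans lee le_v) (leq_trans lee le_v).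
Qed.

Lemma build_dissection m K s : 0 < m -> part m K s -> dissection m K (build m s).
Proof.
move=> m_gt0; elim/last_ind: s K => [|s v IH] [|K].
- by move=> _; apply: dissection_fset0.
- by case/partP.
- by case/partP; rewrite size_rcons.
- rewrite part_rcons build_rcons => /and3P[ps _ v_le].
  by apply: dissection_glue; rewrite ?subSS ?subn0 //; [apply: dissection_ear | apply: IH].
Qed.

(** The last entry is recovered as the largest left endpoint; removing its ear leaves the dissection
    built from the other entries. *)
Lemma build_inj m K s t : 0 < m -> part m K s -> part m K t -> build m s = build m t -> s = t.
Proof.
move=> m_gt0; elim/last_ind: s K t => [|s v IH] K t.
  by case/partP => <- _ _ /partP[/size0nil ->].
case: K => [|K]; first by case/partP; rewrite size_rcons.
case/lastP: t => [|t w] pv; first by case/partP.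
move=> pw E.
have Evw : v = w.
  apply/eqP; rewrite eqn_leq -{1}(last_rcons 0 t w) -{2}(last_rcons 0 s v).
  rewrite (build_left pw (d := (v, (v + 1 * m).+1))) -?E ?build_ear //.
  by rewrite (build_left pv (d := (w, (w + 1 * m).+1))) ?E ?build_ear.
move: pv pw E; rewrite !part_rcons !build_rcons -Evw => /and3P[ps _ _] /and3P[pt _ _].
have [ncE _] := dissection_ear m_gt0.
have [ncs _] := build_dissection m_gt0 ps; have [nct _] := build_dissection m_gt0 pt.
by case/(glue_inj ncE ncs ncE nct) => _ /(IH _ _ ps pt) ->.
Qed.

(* A shortest arc at the rightmost left endpoint [v] cuts off a dissection all
   of whose arcs start at [v], hence a single cell. *)
Lemma rightmost_ear m K D : 0 < m -> 0 < K -> dissection m K D ->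
  exists2 v, (v, (v + 1 * m).+1) \in D & forall d, d \in D -> d.1 <= v.
Proof.
move=> m_gt0 K_gt0 disD; have base := dissection_base m_gt0 K_gt0 disD.
pose left v := [exists d : D, (val d).1 == v].
have leftI d : d \in D -> left d.1 by move=> dD; apply/existsP; exists [` dD].
have left_ub v : left v -> v <= (K * m).+1.
  case/existsP => d /eqP <-; case/and3P: (disD.1.1 _ (valP d)) => lt12 _.
  exact/leq_trans/(leq_trans (leqnSn _) (ltnW lt12)).
case: (ex_maxnP (ex_intro _ 0 (leftI _ base)) left_ub) => v /existsP[d /eqP dv] max_v.
have {}max_v e : e \in D -> e.1 <= v by move/leftI; apply: max_v.
pose P k := (0 < k) && ((v, (v + k * m).+1) \in D).
have exP : exists k, P k.
  have [k /andP[k_gt0 _] Ek] := arc_gap (disD.1.1 _ (valP d)).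
  exists k; rewrite /P k_gt0 -dv -Ek -surjective_pairing; exact: valP.
case: (ex_minnP exP) => k /andP[k_gt0 kD] min_k; exists v => //.
have [A [B [disA disB lekK lev ED]]] := dissection_unglue disD k_gt0 kD.
suff -> : 1 = k by [].
(* Since [A] has [k] elements, it suffices that its only possible element is its base edge:
   maximality of [v] makes its arcs start at 0, minimality of [k] gives them size [k]. *)
apply/eqP; rewrite eqn_leq k_gt0 -disA.2 -(cardfs1 (0, (k * m).+1)).
apply: fsubset_leq_card; apply/fsubsetP => e eA; rewrite in_fset1.
have eD : shift v e \in D by rewrite ED (in_glue_shift _ _ (disA.1.1 _ eA) disB.1).
have e1 : e.1 = 0 by have := max_v _ eD; rewrite /=; lia.
have [j /andP[j_gt0 lejk]] := arc_gap (disA.1.1 _ eA); rewrite e1 add0n => e2.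
suff Ej : j = k by rewrite [e]surjective_pairing e1 e2 Ej.
apply/eqP; rewrite eqn_leq lejk min_k // /P j_gt0 /=.
by move: eD; rewrite /shift e1 e2 add0n addSn addnC.
Qed.

Lemma build_surj m K D : 0 < m -> dissection m K D -> exists2 s, part m K s & build m s = D.
Proof.
move=> m_gt0; elim: K D => [|K IH] D disD.
  by exists [::]; rewrite // (dissection0 disD).
have [v vD max_v] := rightmost_ear m_gt0 (ltn0Sn K) disD.
have [A [B [disA]]] := dissection_unglue disD (ltn0Sn 0) vD.
rewrite subSS subn0 => disB _ lev ED; have [s ps Es] := IH _ disB.
exists (rcons s v); last by rewrite build_rcons Es ED (dissection1 m_gt0 disA).
rewrite part_rcons ps lev andbT /=; case/lastP: s ps Es => // s w ps Es.
(* The sequence stays increasing: were [v < w], the last ear of [B] would widen to an arc of [D]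
   starting to the right of [v]. *)
have wB : (w, (w + 1 * m).+1) \in B by rewrite -Es build_ear.
have := max_v (widen v (1 * m) (w, (w + 1 * m).+1)).
rewrite ED (in_glue_widen _ _ disA.1 (disB.1.1 _ wB)) wB last_rcons /= /stretch => /(_ isT).
by case: (leqP w v) => // ? ?; lia.
Qed.

(** * Chains of arcs against tight indices *)

(* The arcs of the chain start at [p k] and end at [p k + k * m + 1]. *)
Definition nested (m K : nat) (p : nat -> nat) : Prop :=
  forall j k, j <= k -> k <= K -> p k <= p j /\ p j + j * m <= p k + k * m.

(** Offsets are relative to [p K], so that the polygon of size [K] has its base edge starting at 0
    and the same [p] serves every inner polygon. *)
Definition chain (p : nat -> nat) (m K : nat) (ks : seq nat) (D : {fset nat * nat}) : bool :=
  all (fun k => (p k - p K, (p k - p K + k * m).+1) \in D) ks.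

Definition tight (m : nat) (ks : seq nat) (s : seq nat) : bool :=
  all (fun k => nth 0 s k == k * m) ks.

(** By [nested] the arcs of size below [k] lie under the one of size [k]; shifting by [p k - p K]
    turns offsets from [p k] into offsets from [p K]. *)
Lemma chain_glue p m K k ks A B : 0 < m -> nested m K p -> k <= K ->
  path gtn k ks -> all (ltn 0) ks -> dissection m k A -> dissection m (K - k) B ->
  chain p m K ks (glue (p k - p K) (k * m) A B) = chain p m k ks A.
Proof.
move=> m_gt0 nest lekK; rewrite (path_sortedE (rev_trans ltn_trans)) => /andP[/allP lt_k _].
move=> /allP pos disA disB; apply: eq_in_all => j jks.
have ltjk := lt_k _ jks; have j_gt0 := pos _ jks.
have [le1 le2] := nest _ _ (ltnW ltjk) lekK; have [le3 _] := nest _ _ lekK (leqnn K).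
have arcj : arc m k (p j - p k, (p j - p k + j * m).+1) by apply: arc_mul => //; lia.
rewrite -(in_glue_shift (p k - p K) A arcj disB.1).
by rewrite (_ : shift _ _ = (p j - p K, (p j - p K + j * m).+1)) //; congr pair => /=; lia.
Qed.

(** Induction on the decreasing list [ks]. Its head [k] splits sequences and dissections alike; the
    remaining sizes constrain only the inner parts, matched by induction, and [build] matches the
    outer parts of size [K - k]. *)
Lemma chain_bij m p ks K : 0 < m -> nested m K p -> path gtn K ks -> all (ltn 0) ks ->
  exists f, [/\
    forall s, part m K s -> tight m ks s -> dissection m K (f s) /\ chain p m K ks (f s),
    forall s t, part m K s -> tight m ks s -> part m K t -> tight m ks t -> f s = f t -> s = t &
    forall D, dissection m K D -> chain p m K ks D ->
      exists s, [/\ part m K s, tight m ks s & f s = D]].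
Proof.
move=> m_gt0; elim: ks K => [|k ks IH] K nest.
  move=> _ _; exists (build m); split=> [s ps _|s t ps _ pt _|D disD _].
  - by split=> //; apply: build_dissection.
  - exact: build_inj ps pt.
  - by have [s ps Es] := build_surj m_gt0 disD; exists s.
move=> /= /andP[ltkK pks] /andP[k_gt0 pos]; have lekK := ltnW ltkK.
have nestk : nested m k p by move=> i j leij lejk; apply: nest => //; apply: leq_trans lekK.
have [g [g_dis g_inj g_surj]] := IH _ nestk pks pos.
pose rest s := [seq x - k * m | x <- drop k s].
have lep : p k - p K <= (K - k) * m.
  by have [] := nest _ _ lekK (leqnn K); rewrite mulnBl; lia.
have lt_k j : j \in ks -> j < k.
  by move: pks; rewrite (path_sortedE (rev_trans ltn_trans)) => /andP[lt_ks _]; apply: (allP lt_ks).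
have split_s s : part m K s -> tight m (k :: ks) s ->
    [/\ part m k (take k s), tight m ks (take k s), part m (K - k) (rest s)
      & s = take k s ++ [seq x + k * m | x <- rest s]].
  move=> ps /andP[/eqP tk tks]; have [? ? ?] := part_split ltkK ps tk; split=> //.
  by rewrite /tight (eq_in_all (a2 := fun j => nth 0 s j == j * m)) // => j /lt_k ltj; rewrite nth_take.
exists (fun s => glue (p k - p K) (k * m) (g (take k s)) (build m (rest s))); split.
- move=> s ps ts; have [ps1 ts1 ps2 _] := split_s _ ps ts.
  have [dis1 chain1] := g_dis _ ps1 ts1; have dis2 := build_dissection m_gt0 ps2.
  split; first exact: dissection_glue.
  rewrite /= [X in _ && X](_ : _ = true) ?andbT; last first.
    by rewrite -/(chain p m K ks _) chain_glue.
  (* The arc of size [k] is the shifted base edge of the inner dissection. *)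
  apply/glueP; left; exists (0, (k * m).+1); first exact: dissection_base.
  by rewrite /shift /=; congr pair; lia.
- move=> s t ps ts pt tt; have [ps1 ts1 ps2 Es] := split_s _ ps ts.
  have [pt1 tt1 pt2 Et] := split_s _ pt tt.
  have [[nc1 _] _] := g_dis _ ps1 ts1; have [nc2 _] := build_dissection m_gt0 ps2.
  have [[nc3 _] _] := g_dis _ pt1 tt1; have [nc4 _] := build_dissection m_gt0 pt2.
  case/(glue_inj nc1 nc2 nc3 nc4) => E1 E2.
  by rewrite Es Et (g_inj _ _ ps1 ts1 pt1 tt1 E1) (build_inj m_gt0 ps2 pt2 E2).
- move=> D disD /= /andP[kD chainD].
  have [A [B [disA disB _ _ ED]]] := dissection_unglue disD k_gt0 kD.
  have chainA : chain p m k ks A by rewrite -(chain_glue m_gt0 nest lekK pks pos disA disB) -ED.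
  have [s [ps ts Es]] := g_surj _ disA chainA; have [t pt Et] := build_surj m_gt0 disB.
  have [pst tk] := part_join ltkK ps pt; have /partP[szs _ _] := ps.
  exists (s ++ [seq x + k * m | x <- t]); split=> //.
    rewrite /tight /= tk eqxx /= (eq_in_all (a2 := fun j => nth 0 s j == j * m)) // => j /lt_k ltj.
    by rewrite nth_cat szs ltj.
  rewrite ED take_size_cat // Es /rest drop_size_cat // -map_comp.
  by rewrite (eq_map (g := id)) ?map_id ?Et // => x /=; rewrite addnK.
Qed.

(** * Inclusion-exclusion and key-preserving bijections *)

Lemma count_superset (I : finType) (T : Type) (r : seq T) (key : T -> {set I}) (S : {set I}) :
  count (fun x => S \subset key x) r = \sum_(R : {set I} | S \subset R) count (fun x => key x == R) r.
Proof.
rewrite -sum1_count (partition_big key (fun R : {set I} => S \subset R)) //=.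
apply: eq_bigr => R SR; rewrite -sum1_count; apply: eq_bigl => x.
by case: eqP => [->|]; rewrite ?SR ?andbF.
Qed.

(** Induction on the size of the complement of [S]: the superset count at [S] is the exact count at
    [S] plus exact counts at strictly larger sets, which already agree. *)
Lemma count_exact (I : finType) (T U : Type) (rT : seq T) (rU : seq U)
    (kT : T -> {set I}) (kU : U -> {set I}) :
  (forall S : {set I}, count (fun x => S \subset kT x) rT = count (fun y => S \subset kU y) rU) ->
  forall S : {set I}, count (fun x => kT x == S) rT = count (fun y => kU y == S) rU.
Proof.
move=> sup S; have [n] := ubnP (#|~: S|); elim: n S => // n IH S ltn.
have := sup S; rewrite !count_superset (bigD1 S) //= [X in _ = X](bigD1 S) //=.
rewrite (eq_bigr (fun R : {set I} => count (fun y => kU y == R) rU)); first by move/addIn.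
move=> R /andP[SR neRS]; apply: IH.
have /proper_card : ~: R \proper ~: S by rewrite properEneq setCS SR (inj_eq (@setC_inj I)) neRS.
by move/leq_trans; apply.
Qed.

(** Classes with the same key have equal length, so the element at a given position of one is sent
    to that position of the other. *)
Lemma keyed_bij (T U K : eqType) (u0 : U) (rT : seq T) (rU : seq U) (kT : T -> K) (kU : U -> K) :
  uniq rT -> uniq rU ->
  (forall c, count (fun x => kT x == c) rT = count (fun y => kU y == c) rU) ->
  exists f : T -> U, [/\ forall x, x \in rT -> f x \in rU /\ kU (f x) = kT x,
    {in rT &, injective f} & forall y, y \in rU -> exists2 x, x \in rT & f x = y].
Proof.
move=> uT uU eqc.
pose bT c := [seq x <- rT | kT x == c]; pose bU c := [seq y <- rU | kU y == c].
have szb c : size (bT c) = size (bU c) by rewrite !size_filter eqc.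
have memT x : x \in rT -> x \in bT (kT x) by rewrite mem_filter eqxx.
pose f x := nth u0 (bU (kT x)) (index x (bT (kT x))).
have fP x : x \in rT -> f x \in bU (kT x).
  by move=> /memT xb; rewrite mem_nth // -szb index_mem.
have fkey x : x \in rT -> kU (f x) = kT x by move/fP; rewrite mem_filter => /andP[/eqP].
exists f; split=> [x xT|x y xT yT Exy|y yU].
- by split; [have := fP _ xT; rewrite mem_filter => /andP[] | exact: fkey].
- have Ek : kT x = kT y by rewrite -(fkey _ xT) -(fkey _ yT) Exy.
  have xb := memT _ xT; have yb : y \in bT (kT x) by rewrite Ek memT.
  move/eqP: Exy; rewrite /f -Ek nth_uniq ?filter_uniq // -?szb ?index_mem // => /eqP Eidx.
  by rewrite -(nth_index x xb) Eidx nth_index.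
- have yb : y \in bU (kU y) by rewrite mem_filter eqxx.
  have lti : index y (bU (kU y)) < size (bT (kU y)) by rewrite szb index_mem.
  have x0 : T by case: (bT _) lti.
  pose x := nth x0 (bT (kU y)) (index y (bU (kU y))).
  have xb : x \in bT (kU y) by rewrite mem_nth.
  have /andP[/eqP kx xT] : (kT x == kU y) && (x \in rT) by move: xb; rewrite mem_filter.
  by exists x; rewrite // /f kx /x index_uniq ?filter_uniq // nth_index.
Qed.

Lemma sorted_enum_ord n (S : {set 'I_n}) : sorted (relpre val ltn) (enum S).
Proof.
rewrite /enum_mem; apply: sorted_filter; first by move=> ? ? ?; apply: ltn_trans.
by rewrite -enumT -sorted_map val_enum_ord iota_ltn_sorted.
Qed.

Lemma chain_psi n m (p : nat -> nat) : 0 < m -> nested m n.+1 p ->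
  exists f : {fset nat * nat} -> seq nat, [/\
    forall D, dissection m n.+1 D -> part m n.+1 (f D) /\
      forall i : 'I_n, ((p (n - i) - p n.+1, (p (n - i) - p n.+1 + (n - i) * m).+1) \in D) =
        (nth 0 (f D) (n - i) == (n - i) * m),
    forall D E, dissection m n.+1 D -> dissection m n.+1 E -> f D = f E -> D = E &
    forall s, part m n.+1 s -> exists2 D, dissection m n.+1 D & f D = s].
Proof.
move=> m_gt0 nest; have [rP uP memP] := part_enum m n.+1.
pose rD := map (build m) rP.
have uD : uniq rD.
  by rewrite map_inj_in_uniq // => s t; rewrite !memP => ps pt; apply: build_inj ps pt.
have memD D : D \in rD <-> dissection m n.+1 D.
  split=> [/mapP[s]|/(build_surj m_gt0)[s ps <-]]; first rewrite memP => ps ->.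
    exact: build_dissection.
  by rewrite map_f // memP.
pose kD (D : {fset nat * nat}) := [set i : 'I_n |
  (p (n - i) - p n.+1, (p (n - i) - p n.+1 + (n - i) * m).+1) \in D].
pose kP (s : seq nat) := [set i : 'I_n | nth 0 s (n - i) == (n - i) * m].
have sup (S : {set 'I_n}) :
    count (fun D => S \subset kD D) rD = count (fun s => S \subset kP s) rP.
  (* Index [i] stands for size [n - i], so enumerating [S] increasingly lists sizes from [n] down to
     1 in decreasing order. *)
  pose ks := [seq n - val i | i <- enum S].
  have pks : path gtn n.+1 ks.
    rewrite (path_sortedE (rev_trans ltn_trans)); apply/andP; split.
      by apply/allP => _ /mapP[i _ ->]; rewrite /= ltnS leq_subr.
    rewrite sorted_map; apply: sub_sorted (sorted_enum_ord S) => i j /= ltij.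
    by have := ltn_ord j; lia.
  have pos : all (ltn 0) ks.
    by apply/allP => _ /mapP[i _ ->]; rewrite /= subn_gt0.
  have chainE D : (S \subset kD D) = chain p m n.+1 ks D.
    rewrite /chain all_map; apply/subsetP/allP => H i iS.
      by have := H i; rewrite -mem_enum iS inE => /(_ isT).
    by rewrite inE; apply: H; rewrite mem_enum.
  have tightE s : (S \subset kP s) = tight m ks s.
    rewrite /tight all_map; apply/subsetP/allP => H i iS.
      by have := H i; rewrite -mem_enum iS inE => /(_ isT).
    by rewrite inE; apply: H; rewrite mem_enum.
  have [g [g_dis g_inj g_surj]] := chain_bij m_gt0 nest pks pos.
  rewrite (eq_count chainE) (eq_count tightE) -!size_filter.
  rewrite -(size_map g [seq s <- rP | tight m ks s]); apply/perm_size/uniq_perm.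
  - by rewrite filter_uniq.
  - rewrite map_inj_in_uniq ?filter_uniq // => s t; rewrite !mem_filter !memP.
    by move=> /andP[ts ps] /andP[tt pt]; apply: g_inj.
  - move=> D; rewrite mem_filter; apply/andP/mapP => [[cD /memD dD]|[s]].
      have [s [ps ts Es]] := g_surj _ dD cD; exists s => //.
      by rewrite mem_filter ts memP.
    rewrite mem_filter memP => /andP[ts ps] ->.
    by have [? ?] := g_dis _ ps ts; split=> //; apply/memD.
have [f [f_key f_inj f_surj]] := keyed_bij [::] uD uP (count_exact sup).
exists f; split=> [D /memD /f_key[]|D E /memD dD /memD dE|s].
- rewrite memP => pf /setP Ek; split=> // i.
  by have := Ek i; rewrite !inE.
- exact: f_inj.
- by rewrite -memP => /f_surj[D /memD dD Ef]; exists D.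
Qed.

(** * The snake of negative simple roots and the encoding of dissections *)

(** The root of size [j] has index [n.+1 - j], and half of this is the left endpoint in units of
    [m]. Passing from [k] down to [j] raises the half by at most [k - j]. *)
Lemma snake_nested n m : nested m n.+1 (fun j => (n.+1 - j)./2 * m).
Proof.
move=> j k lejk lek; rewrite -!mulnDl !leq_mul2r; split; apply/orP; right; lia.
Qed.

Definition diagonals N (D : {set 'I_N * 'I_N}) : {fset nat * nat} :=
  [fset (val d.1, val d.2) | d in D].

Definition arcs n m (D : {set 'I_(nverts n m) * 'I_(nverts n m)}) : {fset nat * nat} :=
  (0, (n.+1 * m).+1) |` diagonals D.

Lemma pair_val_inj N : injective (fun d : 'I_N * 'I_N => (val d.1, val d.2)).
Proof. by move=> [x y] [z t] [] /val_inj -> /val_inj ->. Qed.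

Lemma in_diagonals N (D : {set 'I_N * 'I_N}) d : ((val d.1, val d.2) \in diagonals D) = (d \in D).
Proof.
apply/imfsetP/idP => [[e /= eD /(@pair_val_inj N) -> //]|dD].
by exists d.
Qed.

Lemma card_diagonals N (D : {set 'I_N * 'I_N}) : #|` diagonals D| = #|D|.
Proof. by rewrite card_imfset ?cardE //; apply: pair_val_inj. Qed.

(** The vertex counts of the two pieces add up to [n.+1 * m + 4], so one congruence gives the other.
    The upper bound on [b - a] excludes just the base edge. *)
Lemma m_diagonalE n m (d : 'I_(nverts n m) * 'I_(nverts n m)) : 0 < m ->
  is_m_diagonal d = arc m n.+1 (val d.1, val d.2) && ((val d.1, val d.2) != (0, (n.+1 * m).+1)).
Proof.
move=> m_gt0; case: d => -[a lta] [b ltb]; rewrite /is_m_diagonal /arc /= xpair_eqE.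
rewrite /nverts in lta ltb *; rewrite (mulnC m) in lta ltb *.
case: (ltnP a.+1 b) => [ltab|leba]; last by lia.
have -> : (b - a + 1 == 2 %[mod m]) = (m %| b - a.+1).
  by rewrite eqn_mod_dvd; [congr (_ %| _); lia | lia].
case: (boolP (m %| b - a.+1)) => dv; last by rewrite /= !andbF.
case: (leqP (b - a) (n.+1 * m)) => leba; last by lia.
have -> : n.+1 * m + 2 - (b - a) + 1 == 2 %[mod m].
  rewrite eqn_mod_dvd; last by lia.
  rewrite (_ : _ - _ = n.+1 * m - (b - a.+1)); last by lia.
  by rewrite dvdn_sub // dvdn_mull.
by lia.
Qed.

(** The union in [arcs] would hide a base edge already in [D], whence the second clause. *)
Lemma m_dissectionP n m (D : {set 'I_(nverts n m) * 'I_(nverts n m)}) : 0 < m ->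
  is_m_dissection D <-> dissection m n.+1 (arcs D) /\ (0, (n.+1 * m).+1) \notin diagonals D.
Proof.
move=> m_gt0; have crE (d e : 'I_(nverts n m) * 'I_(nverts n m)) :
  crossing d e = cross (val d.1, val d.2) (val e.1, val e.2) by rewrite /crossing /cross !andbA.
split=> [/and3P[/eqP cD /forall_inP diagD /forall_inP crD]|[[[arcD crD] cD] base]].
  have base : (0, (n.+1 * m).+1) \notin diagonals D.
    apply/imfsetP => -[d /= dD Ed]; have := diagD _ dD.
    by rewrite m_diagonalE // -Ed eqxx andbF.
  split=> //; split; last by rewrite cardfsU1 base card_diagonals cD.
  apply: noncrossing_base => //; split.
    by move=> _ /imfsetP[d /= /diagD + ->]; rewrite m_diagonalE // => /andP[].
  move=> _ _ /imfsetP[d /= dD ->] /imfsetP[e /= eD ->].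
  by rewrite -crE; have /forall_inP := crD _ dD; apply.
have inA d : d \in D -> (val d.1, val d.2) \in arcs D by rewrite -in_diagonals; apply: fset1Ur.
apply/and3P; split.
- by move/eqP: cD; rewrite cardfsU1 base card_diagonals add1n eqSS.
- apply/forall_inP => d dD; rewrite m_diagonalE // arcD ?inA //.
  by apply: contra base => /eqP <-; rewrite in_diagonals.
- apply/forall_inP => d dD; apply/forall_inP => e eD; rewrite crE crD ?inA //.
Qed.

Lemma arcs_inj n m (D E : {set 'I_(nverts n m) * 'I_(nverts n m)}) : 0 < m ->
  is_m_dissection D -> is_m_dissection E -> arcs D = arcs E -> D = E.
Proof.
move=> m_gt0 /(m_dissectionP _ m_gt0)[_ nD] /(m_dissectionP _ m_gt0)[_ nE] EDE.
apply/setP => d; rewrite -!in_diagonals.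
by rewrite -(fsetU1K nD) -(fsetU1K nE) -/(arcs D) -/(arcs E) EDE.
Qed.

Lemma arcs_surj n m (E : {fset nat * nat}) : 0 < m -> dissection m n.+1 E ->
  exists2 D : {set 'I_(nverts n m) * 'I_(nverts n m)}, is_m_dissection D & arcs D = E.
Proof.
move=> m_gt0 disE; have base := dissection_base m_gt0 (ltn0Sn n) disE.
pose D := [set d : 'I_(nverts n m) * 'I_(nverts n m) |
  ((val d.1, val d.2) \in E) && ((val d.1, val d.2) != (0, (n.+1 * m).+1))].
have ED : arcs D = E.
  apply/fsetP => d; apply/fset1UP/idP => [[-> //|/imfsetP[e /=]]|dE].
    by rewrite inE => /andP[eE _ ->].
  case: (eqVneq d (0, (n.+1 * m).+1)) => [|Nbase]; [by left | right].
  have /and3P[lt12 _ le2] := disE.1.1 _ dE.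
  have lt2 : d.2 < nverts n m by rewrite /nverts mulnC addn2 ltnS.
  have lt1 : d.1 < nverts n m := ltn_trans (ltnW lt12) lt2.
  have Ed : (val (Ordinal lt1), val (Ordinal lt2)) = d by rewrite /= -surjective_pairing.
  rewrite -{1}Ed (in_diagonals D (Ordinal lt1, Ordinal lt2)) inE /=.
  by rewrite -surjective_pairing dE.
exists D => //; apply/m_dissectionP; rewrite // ED; split=> //.
by apply/imfsetP => -[d /=]; rewrite inE => /andP[_ /eqP Nb] /esym.
Qed.

(** Half of the index, rounded down, is [k - 1] for index [2k - 1] and [k] for index [2k], which
    merges the two cases. *)
Lemma neg_simple_rootE n m i : i < n ->
  neg_simple_root n m i.+1 = (i.+1./2 * m, (i.+1./2 * m + (n - i) * m).+1).
Proof.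
move=> ltin; rewrite /neg_simple_root -mulnDl; case: ifP => odd_i; rewrite addn1.
  by congr (_ * _, (_ * _).+1); lia.
by congr (_ * _, (_ * _).+1); lia.
Qed.

Lemma contains_neg_simpleE n m (D : {set 'I_(nverts n m) * 'I_(nverts n m)}) i : 0 < m -> i < n ->
  contains_neg_simple i.+1 D = ((i.+1./2 * m, (i.+1./2 * m + (n - i) * m).+1) \in arcs D).
Proof.
move=> m_gt0 ltin; rewrite in_fset1U xpair_eqE eqSS -mulnDl eqn_pmul2r //.
(* The base edge added by [arcs] has size [n.+1] and so is not the root of size [n - i]. *)
rewrite (_ : _ == n.+1 = false) ?andbF; last by lia.
rewrite mulnDl -neg_simple_rootE //.
apply/exists_inP/imfsetP => [[d dD /eqP Ed]|[d /= dD ->]]; by exists d.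
Qed.

Theorem theorem1p4 (n m : nat) (hn : 0 < n) (hm : 0 < m) :
  exists psi : {set 'I_(nverts n m) * 'I_(nverts n m)} -> n.-tuple nat,
    [/\ (forall D, @is_m_dissection n m D -> @is_mpartition n m (psi D)),
        {in [pred D | @is_m_dissection n m D] &, injective psi},
        (forall la, @is_mpartition n m la ->
           exists2 D, @is_m_dissection n m D & psi D = la) &
        (forall D, @is_m_dissection n m D -> forall i : 'I_n,
           @contains_neg_simple n m i.+1 D = (tnth (psi D) i == (n - i) * m))].
Proof.
have [f [f_part f_inj f_surj]] := chain_psi hm (@snake_nested n m).
(* The increasing sequence is read backwards and its entry 0 is dropped. *)
pose psi D := [tuple nth 0 (f (@arcs n m D)) (n - j) | j < n].
have psiE D (j : 'I_n) : tnth (psi D) j = nth 0 (f (arcs D)) (n - j) by rewrite tnth_mktuple.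
have disA D : is_m_dissection D -> dissection m n.+1 (@arcs n m D).
  by case/(m_dissectionP D hm).
exists psi; split=> [D /disA /f_part[/partP[_ srt bnd] _]|D E dD dE EDE|la|D dD i].
- apply/andP; split; apply/forallP => j; first by rewrite psiE mulnC bnd // ltnS leq_subr.
  apply/forallP => k; apply/implyP => lejk; rewrite !psiE srt ?ltnS ?leq_subr //.
  exact: leq_sub2l.
- apply: arcs_inj => //; apply: f_inj; [exact: disA|exact: disA|].
  have [/partP[szD _ bD] _] := f_part _ (disA _ dD).
  have [/partP[szE _ bE] _] := f_part _ (disA _ dE).
  (* The dropped entry is 0 on both sides by its bound; entry [i.+1] is read off at position
     [n - i.+1]. *)
  apply: (@eq_from_nth _ 0); rewrite szD ?szE // => -[_|i]; first by move: (bD 0) (bE 0); lia.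
  rewrite ltnS => ltin; have ltj : n - i.+1 < n by lia.
  have := congr1 (fun t => tnth t (Ordinal ltj)) EDE; rewrite /= !psiE /=.
  by rewrite (_ : n - (n - i.+1) = i.+1) //; lia.
- case/andP => /forallP bnd /forallP srt.
  pose s := mkseq (fun i => if i == 0 then 0 else nth 0 la (n - i)) n.+1.
  have nth_s (j : 'I_n) : nth 0 s (n - j) = tnth la j.
    rewrite nth_mkseq ?ltnS ?leq_subr // (tnth_nth 0).
    by rewrite subn_eq0 leqNgt ltn_ord /= subKn // ltnW.
  have idx i : 0 < i -> i <= n -> exists2 j : 'I_n, i = n - j & nth 0 s i = tnth la j.
    move=> i_gt0 lein; have ltj : n - i < n by lia.
    have Ei : i = n - Ordinal ltj by rewrite /= subKn.
    by exists (Ordinal ltj); rewrite // -nth_s -Ei.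
  have s0 : nth 0 s 0 = 0 by rewrite nth_mkseq.
  have ps : part m n.+1 s.
    apply/partP; split=> [|i j leij ltj|i lti]; first by rewrite size_mkseq.
      case: (posnP i) => [->|i_gt0]; first by rewrite s0.
      have [k Ei ->] := idx i i_gt0 (leq_trans leij ltj).
      have [l Ej ->] := idx j (leq_trans i_gt0 leij) ltj.
      have /forallP/(_ k)/implyP := srt l; apply; have := ltn_ord k; lia.
    case: (posnP i) => [->|i_gt0]; first by rewrite s0.
    by have [k -> ->] := idx i i_gt0 lti; rewrite mulnC bnd.
  have [E dE EfE] := f_surj _ ps; have [D dD ED] := arcs_surj hm dE.
  by exists D => //; apply: eq_from_tnth => j; rewrite psiE ED EfE nth_s.
- have [_ /(_ i) key] := f_part _ (disA _ dD); move: key.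
  (* The snake has offset 0 at size [n.+1], and size [n - i] belongs to the root of index [i.+1]. *)
  rewrite subnn subn0 (_ : n.+1 - (n - i) = i.+1); last by have := ltn_ord i; lia.
  by rewrite psiE contains_neg_simpleE // => ->.
Qed.
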